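(* There is a universal constant $C$ such that the following holds. Let $n,d\ge1$ and $k>2$ be integers with $dn\ge2$, let $X_1,\dots,X_n\in\mathbb{R}^d$, and let $s_i=\sqrt2\,\|X_i\|_2$ for every $i$. There exists an implementation of the variable-length coding protocol $\pi_{svk}$ whose expected total number of transmitted bits satisfies $$\mathcal{C}(\pi_{svk},X^n)\;\le\; n\left(d\left(2+\log_2\left(\frac{(k-1)^2}{2d}+\frac54\right)\right)+k\log_2\frac{(d+k)e}{k}+C\log(dn)\right).$$
   Context: Client $i$ holds $X_i\in\mathbb{R}^d$; $X^n=(X_1,\dots,X_n)$, $X_i^{\max}=\max_jX_i(j)$, $X_i^{\min}=\min_jX_i(j)$ (note $X_i^{\max}-X_i^{\min}\le\sqrt2\|X_i\|_2$). Quantization (as in stochastic $k$-level quantization): put $B_i(r)=X_i^{\min}+\frac{rs_i}{k-1}$ for integers $0\le r<k$. Independently for all $i,j$: if $X_i(j)\in[B_i(r),B_i(r+1))$ then $Y_i(j)=B_i(r+1)$ with probability $\frac{X_i(j)-B_i(r)}{B_i(r+1)-B_i(r)}$ and $Y_i(j)=B_i(r)$ otherwise; if $X_i(j)=B_i(k-1)$ then $Y_i(j)=X_i(j)$. The bin index of coordinate $j$ is the $r\in\{0,\dots,k-1\}$ with $Y_i(j)=B_i(r)$ (index $0$ for all coordinates if $s_i=0$). In $\pi_{svk}$, client $i$ transmits $X_i^{\min}$, $s_i$ and the vector of bin indices in $\{0,\dots,k-1\}^d$, the latter by a lossless variable-length code: first the counts $h_r$ = number of coordinates with bin index $r$, $0\le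 r<k$, are encoded, and then the index vector is encoded by an arithmetic or Huffman code for the distribution $p_r=h_r/d$. An implementation is a choice of uniquely decodable binary encoding of each client's message, from which the server recovers the bin-index vector exactly and the two real numbers $X_i^{\min},s_i$ up to additive error $N/(nd)^3$, where $N$ is an upper bound, known to all parties, on the norms $\|X_i\|_2$ (the effect of this precision error is ignored). $\mathcal{C}(\pi_{svk},X^n)$ is the sum over clients of the expected number of bits sent, the expectation being over the randomness of the quantization. *)

(* Defs.v *)
From HB Require Import structures.
From mathcomp Require Import all_boot all_order all_algebra.
From mathcomp Require Import all_classical all_reals all_analysis.

Set Implicit Arguments.
Unset Strict Implicit.
Unset Printing Implicit Defensive.

Import Order.TTheory GRing.Theory Num.Theory.

Local Open Scope classical_set_scope.
Local Open Scope ring_scope.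

Definition log2 (R : realType) (x : R) : R := ln x / ln 2.

(* The library's norm on matrices is the sup norm, hence this definition. *)
Definition l2norm (R : realType) (d : nat) (x : 'rV[R]_d) : R :=
  Num.sqrt (\sum_j x ord0 j ^+ 2).

(* A minimum for 0 < d (junk value 0 for d = 0). *)
Definition xmin (R : realType) (d : nat) (x : 'rV[R]_d) : R :=
  inf (range (x ord0)).

Definition level (R : realType) (k : nat) (m s : R) (r : nat) : R :=
  m + r%:R * s / (k.-1)%:R.

(* The probability that Y = y, when Y is the quantized value of a coordinate  *)
(* x.  At most one of the half-open bins contains x.                          *)
Definition quant_law (R : realType) (k : nat) (m s x y : R) : R :=
  let B := level k m s in
  if x == B k.-1 then (y == x)%:R
  else \sum_(r < k.-1 | B r <= x < B r.+1)
         (let up := (x - B r) / (B r.+1 - B r) in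
          (y == B r.+1)%:R * up + (y == B r)%:R * (1 - up)).

(* The probability that the bin index of x is r: for s != 0 the levels are    *)
(* distinct, so the bin index is r exactly when Y = B r.                      *)
Definition bin_law (R : realType) (k : nat) (m s x : R) (r : 'I_k) : R :=
  if s == 0 then (val r == 0)%N%:R else quant_law k m s x (level k m s r).

(* The coordinates are quantized independently. *)
Definition index_law (R : realType) (d k : nat) (s : R) (x : 'rV[R]_d)
    (v : {ffun 'I_d -> 'I_k}) : R :=
  \prod_j bin_law (xmin x) s (x ord0 j) (v j).

Definition counts (d k : nat) (v : {ffun 'I_d -> 'I_k}) : {ffun 'I_k -> nat} :=
  [ffun r => #|[set j | v j == r]%SET|].

Definition freq (R : realType) (d k : nat) (h : {ffun 'I_k -> nat})
    (r : 'I_k) : R := (h r)%:R / d%:R.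

Definition supported (R : realType) (d k : nat) (p : 'I_k -> R)
    (v : {ffun 'I_d -> 'I_k}) : Prop := forall j, 0 < p (v j).

(* Arithmetic coding assigns to v the interval                                *)
(*   [arith_low p v, arith_low p v + arith_width p v[                         *)
(* obtained by successively subdividing [0, 1[ proportionally to p.           *)
Definition arith_low (R : realType) (d k : nat) (p : 'I_k -> R)
    (v : {ffun 'I_d -> 'I_k}) : R :=
  \sum_(j < d) (\prod_(l < d | (l < j)%N) p (v l)) *
               (\sum_(r < k | (r < v j)%N) p r).

Definition arith_width (R : realType) (d k : nat) (p : 'I_k -> R)
    (v : {ffun 'I_d -> 'I_k}) : R := \prod_(j < d) p (v j).

(* The real number with binary expansion 0.b. *)
Definition binfrac (R : realType) (b : bitseq) : R :=
  \sum_(t < size b) (nth false b t)%:R / 2 ^+ t.+1.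

(* The codeword b of v designates the dyadic interval of all the reals whose  *)
(* binary expansion starts with 0.b; it must lie in the interval of v.        *)
Definition arithmetic_code (R : realType) (d k : nat) (p : 'I_k -> R)
    (c : {ffun 'I_d -> 'I_k} -> bitseq) : Prop :=
  forall v, supported p v ->
    arith_low p v <= binfrac R (c v) /\
    binfrac R (c v) + 2 ^- size (c v) <= arith_low p v + arith_width p v.

(* Huffman's algorithm: a forest is a sequence of trees, a tree being given   *)
(* by its weight and its code table; two trees of least weight are merged     *)
(* until a single tree is left.                                               *)
Inductive huffman (R : realType) (T : eqType) :
    seq (R * seq (T * bitseq)) -> seq (T * bitseq) -> Prop :=
| HuffmanDone w t : huffman [:: (w, t)] t
| HuffmanMerge f a b rest t :
    perm_eq f (a :: b :: rest) ->
    (forall x, x \in rest -> a.1 <= x.1 /\ b.1 <= x.1) ->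
    huffman ((a.1 + b.1, [seq (u.1, false :: u.2) | u <- a.2] ++
                         [seq (u.1, true :: u.2) | u <- b.2]) :: rest) t ->
    huffman f t.

(* Symbols of probability 0 get no codeword. *)
Definition huffman_code (R : realType) (d k : nat) (p : 'I_k -> R)
    (c : {ffun 'I_d -> 'I_k} -> bitseq) : Prop :=
  exists (t : seq ('I_k * bitseq)) (c0 : 'I_k -> bitseq),
    [/\ huffman [seq (p r, [:: (r, [::])]) | r <- enum 'I_k & 0 < p r] t,
        forall u, u \in t -> c0 u.1 = u.2
      & forall v, supported p v -> c v = flatten [seq c0 (v j) | j <- enum 'I_d]].

Definition uniquely_decodable (W : set bitseq) : Prop :=
  forall us ws : seq bitseq,
    (forall u, u \in us -> W u) -> (forall w, w \in ws -> W w) ->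
    flatten us = flatten ws -> us = ws.

Record svk_coding (R : realType) (n d k : nat) := SvkCoding {
  enc_reals : 'I_n -> R -> R -> bitseq;
  enc_counts : 'I_n -> {ffun 'I_k -> nat} -> bitseq;
  enc_index : 'I_n -> {ffun 'I_k -> nat} -> {ffun 'I_d -> 'I_k} -> bitseq
}.

Definition message (R : realType) (n d k : nat) (P : svk_coding R n d k)
    (i : 'I_n) (m s : R) (v : {ffun 'I_d -> 'I_k}) : bitseq :=
  enc_reals P i m s ++ enc_counts P i (counts v) ++
  enc_index P i (counts v) v.

(* P implements the protocol with s_i = scale X_i, for data of norm at most N.*)
(* P does not depend on the data: the messages of all the vectors of norm at  *)
(* most N, with all index vectors, have to be decodable.                      *)
Definition svk_implementation (R : realType) (n d k : nat) (N : R)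
    (scale : 'rV[R]_d -> R) (P : svk_coding R n d k) : Prop :=
  forall i : 'I_n,
  [/\ forall v w : {ffun 'I_d -> 'I_k},
        enc_counts P i (counts v) = enc_counts P i (counts w) ->
        counts v = counts w,
      forall v : {ffun 'I_d -> 'I_k},
        let p : 'I_k -> R := freq R d (counts v) in
        arithmetic_code p (enc_index P i (counts v)) \/
        huffman_code p (enc_index P i (counts v)),
      uniquely_decodable
        [set b | exists (x : 'rV[R]_d) (v : {ffun 'I_d -> 'I_k}),
                   l2norm x <= N /\ b = message P i (xmin x) (scale x) v]
    & exists dec : bitseq -> R * R * {ffun 'I_d -> 'I_k},
        forall (x : 'rV[R]_d) (v : {ffun 'I_d -> 'I_k}), l2norm x <= N ->
          let: (m', s', v') := dec (message P i (xmin x) (scale x) v) in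
          [/\ `|m' - xmin x| <= N / (n * d)%:R ^+ 3,
              `|s' - scale x| <= N / (n * d)%:R ^+ 3
            & v' = v]].

Definition svk_cost (R : realType) (n d k : nat) (scale : 'rV[R]_d -> R)
    (P : svk_coding R n d k) (X : 'I_n -> 'rV[R]_d) : R :=
  \sum_(i < n) \sum_(v : {ffun 'I_d -> 'I_k})
    index_law (scale (X i)) (X i) v *
    (size (message P i (xmin (X i)) (scale (X i)) v))%:R.

(* Main.v *)
(* Each client concatenates three codewords: a fixed-length code of both      *)
(* reals rounded to multiples of N / (nd)^3, a fixed-length code of the       *)
(* counts, of which there are at most 'C(d + k, k) <= ((d + k) e / k)^k, and  *)
(* an arithmetic codeword, which exceeds the empirical entropy                *)
(* - \sum_j log2 (p (v j)) by at most 2 bits.  By Gibbs' inequality the       *)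
(* entropy is at most the cross entropy against the distribution q            *)
(* proportional to 1 / w, w r = (a + r)^2 + 1, a = (k - 1) xmin / s.  Here    *)
(* a + r = (k - 1) (level r) / s, so the expected mean of w over the          *)
(* coordinates is the expected mean of ((k - 1) Y / s)^2 + 1, which is at     *)
(* most (k - 1)^2 / (2d) + 5 / 4 because quantization is unbiased and has     *)
(* variance at most (s / (k - 1))^2 / 4.  The normalization \sum_r 1 / w r is *)
(* at most 4 for every a, which gives the 2 = log2 4 of the bound.            *)
Require Import Defs.
From mathcomp Require Import all_boot all_order all_algebra.
From mathcomp Require Import all_classical all_reals all_analysis.
From mathcomp Require Import ring lra zify.

Import Order.TTheory GRing.Theory Num.Theory.

Local Open Scope ring_scope.

(** The bit count combines a bound valid for every index vector with a first-moment computation.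
    Given the counts, an arithmetic codeword costs at most two bits more than minus the binary
    logarithm of the interval width ([exists_arithmetic_code], through [exists_dyadic]), and that
    logarithm is the empirical entropy of the index vector.

    [empirical_entropy_le] bounds this entropy by an expression affine in the sum of the weights
    [wt (v j)]: concavity of the logarithm enters only through its tangent at [M]. Averaging
    therefore needs only the mean weights, computed in [bin_law_moments] and [expected_weight_le].
    Averaged over the coordinates they are at most [M], so the linear terms cancel; [sum_cauchy_le4]
    supplies the normalization.

    For decodability, the first two parts of a message have fixed length, and arithmetic intervals
    of distinct index vectors with the same counts are disjoint, so the messages form a prefix-free
    set. *)

(** * Fixed-length codes, prefix-free sets and the code of the counts *)

Lemma exists_fixed_length_code {T : finType} (A : {set T}) (L : nat) :
  (#|A| <= 2 ^ L)%N ->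
  exists f : T -> bitseq,
    {in A &, injective f} /\ forall x, size (f x) = L.
Proof.
move=> leA.
pose words := enum {: L.-tuple bool}.
have size_words : size words = (2 ^ L)%N.
  by rewrite -cardE card_tuple card_bool.
exists (fun x => val (nth (nseq_tuple L false) words (index x (enum A)))).
split=> [x y Ax Ay /val_inj /eqP|x]; last exact: size_tuple.
have idx z : z \in A -> (index z (enum A) < size words)%N.
  move=> Az; rewrite size_words (leq_trans _ leA)// cardE index_mem.
  by rewrite mem_enum.
rewrite nth_uniq ?idx ?enum_uniq// => /eqP; apply: (index_inj x);
  by rewrite mem_enum.
Qed.

(** Stated through common continuations, the form in which it follows from disjoint intervals. *)
Definition prefix_free (W : set bitseq) : Prop :=
  forall u w a b : bitseq, W u -> W w -> u ++ a = w ++ b -> u = w.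

(** Codewords are peeled off one by one. The empty word is excluded because [[::]] and [[:: [::]]]
    flatten to the same word. *)
Lemma prefix_free_uniquely_decodable (W : set bitseq) :
  prefix_free W -> ~ W [::] -> uniquely_decodable W.
Proof.
move=> Wpf Wnil; elim=> [|u us IH] [|w ws] //=.
- move=> _ /(_ w (mem_head _ _)); case: w => // /Wnil [].
- move=> /(_ u (mem_head _ _)) + _; case: u => // /Wnil [].
move=> Wu Ww e.
have uw : u = w.
  by apply: (Wpf _ _ _ _ (Wu _ (mem_head _ _)) (Ww _ (mem_head _ _)) e).
move: e; rewrite uw => /eqP; rewrite eqseq_cat// eqxx/= => /eqP /IH -> //.
- by move=> v vus; apply: Wu; rewrite inE vus orbT.
- by move=> v vws; apply: Ww; rewrite inE vws orbT.
Qed.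

Lemma up_log2_le {R : realType} (m : nat) :
  (0 < m)%N -> (up_log 2 m)%:R <= log2 m%:R + 1 :> R.
Proof.
move=> m0; have ln2 : 0 < ln 2 :> R by rewrite ln_gt0// ltr1n.
have [m1|m1] := leqP m 1.
  have -> : m = 1%N by apply/eqP; rewrite eqn_leq m1.
  by rewrite up_log1 /log2 ln1 mul0r add0r ler01.
have /= /andP[lt _] := @up_log_bounds 2 m isT m1.
have : (0 < up_log 2 m)%N by rewrite up_log_gt0.
case: (up_log 2 m) lt => //= L lt _.
rewrite -natr1 lerD2r /log2 ler_pdivlMr// mulr_natl -lnXn//.
by rewrite ler_ln ?posrE ?exprn_gt0 ?ltr0n// -natrX ler_nat ltnW.
Qed.

Lemma sum_counts {d k : nat} (v : {ffun 'I_d -> 'I_k}) :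
  (\sum_r counts v r = d)%N.
Proof.
rewrite -[RHS]card_ord -sum1_card (partition_big v predT)//=.
apply: eq_bigr => r _; rewrite ffunE -sum1_card.
by apply: eq_bigl => j; rewrite inE.
Qed.

(** Combines 'C(n, k) k! <= n^k with k^k / k! <= e^k; the latter holds because the left side is one
    term of the exponential series at [k]. *)
Lemma bin_le_expR {R : realType} (d k : nat) : (0 < k)%N ->
  'C(d + k, k)%:R <= (((d%:R + k%:R) * expR 1 / k%:R) ^+ k : R).
Proof.
move=> k0; have k0' : 0 < k%:R :> R by rewrite ltr0n.
have ffact_le m n : (n ^_ m <= n ^ m)%N.
  rewrite ffact_prod -[X in (_ <= _ ^ X)%N]card_ord -prod_nat_const.
  by apply: leq_prod => i _; rewrite leq_subr.
have kfact : k%:R ^+ k <= expR 1 ^+ k * (k`!)%:R :> R.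
  rewrite -ler_pdivrMr ?ltr0n ?fact_gt0// -expRM_natl mulr1.
  case: k k0 k0' => // k _ _.
  by apply: le_trans (expR_ge1Dxn k (ler0n _ _)); rewrite lerDr.
rewrite -(ler_pM2r (exprn_gt0 k k0')) -exprMn divfK ?gt_eqF// exprMn.
apply: (@le_trans _ _ ('C(d + k, k)%:R * (expR 1 ^+ k * (k`!)%:R))).
  by rewrite ler_wpM2l.
rewrite mulrCA mulrC ler_wpM2r ?exprn_ge0 ?expR_ge0//.
by rewrite -natrM bin_ffact -natrD -natrX ler_nat.
Qed.

(** Stars and bars gives exactly 'C(d + k - 1, k - 1), one of the two terms of Pascal's rule for
    'C(d + k, k). *)
Lemma card_counts_le (d k : nat) : (0 < k)%N ->
  (#|[set t : k.-tuple 'I_d.+1 | (\sum_(i <- t) i == d)%N]%SET| <= 'C(d + k, k))%N.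
Proof.
case: k => // k _; rewrite card_ord_partitions addnS addnC binS.
exact: leq_addl.
Qed.

Lemma exists_counts_code {R : realType} (d k : nat) : (0 < k)%N ->
  exists (L : nat) (f : {ffun 'I_k -> nat} -> bitseq),
    [/\ forall v w : {ffun 'I_d -> 'I_k},
          f (counts v) = f (counts w) -> counts v = counts w,
        forall h, size (f h) = L
      & L%:R <= k%:R * log2 ((d%:R + k%:R) * expR 1 / k%:R) + 1 :> R].
Proof.
move=> k0; have k0' : 0 < k%:R :> R by rewrite ltr0n.
set A := [set t : k.-tuple 'I_d.+1 | (\sum_(i <- t) i == d)%N]%SET.
have [f [f_inj f_size]] := @exists_fixed_length_code _ A _ (@up_logP 2 #|A| isT).
(* Actual counts are at most [d], so [inord] is faithful on them; other [h] may collide. *)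
pose t (h : {ffun 'I_k -> nat}) := [tuple (inord (h r) : 'I_d.+1) | r < k].
have count_lt (v : {ffun 'I_d -> 'I_k}) r : (counts v r < d.+1)%N.
  by rewrite ffunE -[X in (_ < X.+1)%N]card_ord ltnS max_card.
have tA (v : {ffun 'I_d -> 'I_k}) : t (counts v) \in A.
  rewrite inE big_tuple -[X in _ == X](sum_counts v); apply/eqP.
  by apply: eq_bigr => r _; rewrite tnth_mktuple inordK.
have card_le : (#|A| <= 'C(d + k, k))%N := card_counts_le d k k0.
exists (up_log 2 #|A|), (f \o t); split=> [v w /= /f_inj e|h|].
- apply/ffunP => r; have := congr1 (fun u => val (tnth u r)) (e (tA _) (tA _)).
  by rewrite /= !tnth_mktuple /= ?inordK.
- exact: f_size.
have [A0|A0] := posnP #|A|.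
  rewrite A0 up_log0 addr_ge0// mulr_ge0// divr_ge0// ln_ge0 ?ler1n//.
  rewrite ler_pdivlMr// mul1r -[leLHS]mulr1 ler_pM// ?lerDr//.
  by rewrite ltW// expR_gt1.
apply: le_trans (up_log2_le _ A0) _; rewrite lerD2r.
rewrite /log2 mulrA ler_wpM2r ?invr_ge0 ?ln_ge0 ?ler1n//.
rewrite mulr_natl -lnXn; last first.
  by rewrite divr_gt0// mulr_gt0 ?expR_gt0// ltr_wpDl.
rewrite ler_ln ?posrE ?ltr0n//; last first.
  by rewrite exprn_gt0// divr_gt0// mulr_gt0 ?expR_gt0// ltr_wpDl.
by apply: le_trans (bin_le_expR d k k0); rewrite ler_nat.
Qed.

(** * Binary expansions and dyadic intervals *)

Lemma binfrac_cons {R : realType} (b : bool) (s : bitseq) :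
  binfrac R (b :: s) = (b%:R + binfrac R s) / 2.
Proof.
rewrite /binfrac big_ord_recl /= expr1 mulrDl; congr (_ + _).
rewrite mulr_suml; apply: eq_bigr => i _.
by rewrite exprS invfM mulrA mulrAC.
Qed.

Lemma binfrac_nil {R : realType} : binfrac R [::] = 0.
Proof. by rewrite /binfrac big_ord0. Qed.

Lemma binfrac_bounds {R : realType} (s : bitseq) :
  0 <= binfrac R s < 1.
Proof.
elim: s => [|b s /andP[s0 s1]]; first by rewrite binfrac_nil lexx ltr01.
by rewrite binfrac_cons; case: b => /=; lra.
Qed.

Lemma binfrac_cat {R : realType} (a b : bitseq) :
  binfrac R (a ++ b) = binfrac R a + 2 ^- size a * binfrac R b.
Proof.
elim: a => [|x a IH] /=; first by rewrite binfrac_nil expr0 invr1 mul1r add0r.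
by rewrite !binfrac_cons IH exprS invfM; lra.
Qed.

Lemma exists_binfrac {R : realType} (L m : nat) : (m < 2 ^ L)%N ->
  exists2 b : bitseq, size b = L & binfrac R b = m%:R / 2 ^+ L.
Proof.
elim: L m => [|L IH] m.
  case: m => // _; exists [::] => //; by rewrite binfrac_nil mul0r.
rewrite expnS mul2n -addnn => lt_m.
have [lt|ge] := ltnP m (2 ^ L).
  have [b <- bE] := IH _ lt; exists (false :: b) => //.
  by rewrite binfrac_cons bE add0r exprSr invfM mulrA.
have [|b sb bE] := IH (m - 2 ^ L)%N; first by lia.
exists (true :: b); rewrite /= ?sb// binfrac_cons bE natrB// natrX.
by rewrite mulrBl divff ?expf_neq0 ?pnatr_eq0//= subrKC exprSr invfM mulrA.
Qed.

(** An interval at least two cells of size 2^-L wide contains a whole cell. The least such [L]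
    satisfies 2^L <= 4 / w, which is the overhead of two bits. *)
Lemma exists_dyadic {R : realType} (lo w : R) :
  0 <= lo -> 0 < w -> lo + w <= 1 ->
  exists b : bitseq,
    [/\ lo <= binfrac R b, binfrac R b + 2 ^- size b <= lo + w
      & (2 ^+ size b : R) <= 4 / w].
Proof.
move=> lo0 w0 low1; have w1 : w <= 1 by lra.
have ubL : exists L, 2 / w <= (2 ^+ L : R).
  exists (Num.truncn (2 / w)).+1.
  apply: (@le_trans _ _ (Num.truncn (2 / w)).+1%:R).
    by have /andP[_ /ltW] := truncn_itv (divr_ge0 (ler0n R 2) (ltW w0)).
  by rewrite -natrX ler_nat ltnW// ltn_expl.
case: (ex_minnP ubL) => L leL minL.
have L4 : 2 ^+ L <= 4 / w.
  case: L leL minL => [|L] _ minL.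
    by rewrite expr0 ler_pdivlMr//; lra.
  have : ~~ (2 / w <= (2 ^+ L : R)).
    by apply/negP => /minL; rewrite ltnn.
  by rewrite -ltNge ltr_pdivlMr// => lt; rewrite ler_pdivlMr// exprS; lra.
have p0 : 0 < 2 ^+ L :> R by rewrite exprn_gt0.
have wL : 2 <= w * 2 ^+ L by move: leL; rewrite ler_pdivrMr// mulrC.
have mid0 : 0 <= lo * 2 ^+ L by rewrite mulr_ge0// ltW.
have /andP[tl tu] := truncn_itv mid0.
(* The chosen cell is number m + 1, the first one starting to the right of [lo]. *)
set m := Num.truncn _ in tl tu.
have m1 : m.+2%:R <= (lo + w) * 2 ^+ L.
  by move: tl tu; rewrite -[m.+2]addn2 -addn1 !natrD mulrDl; lra.
have mlt : (m.+1 < 2 ^ L)%N.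
  rewrite -(ltr_nat R) natrX; apply: lt_le_trans (_ : (lo + w) * 2 ^+ L <= _).
    by apply: lt_le_trans m1; rewrite ltr_nat.
  by rewrite ler_piMl// ltW.
have [b sb bE] := @exists_binfrac R _ _ mlt; exists b; split.
- by rewrite bE ler_pdivlMr// ltW.
- rewrite bE sb -[X in _ + X]mul1r -mulrDl natr1.
  by rewrite ler_pdivrMr.
- by rewrite sb.
Qed.

(** * Arithmetic coding *)

Section ArithmeticCoding.
Context {R : realType} {d k : nat} (p : 'I_k -> R).
Context (p_ge0 : forall r, 0 <= p r) (p_le1 : \sum_r p r <= 1).
Implicit Types v w : {ffun 'I_d -> 'I_k}.

Let cum (r : 'I_k) : R := \sum_(r' < k | (r' < r)%N) p r'.
(* The interval of v after the first m subdivisions is                        *)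
(* [low v m, low v m + wid v m[.                                              *)
Let low v (m : nat) : R := \sum_(j < d | (j < m)%N)
  (\prod_(l < d | (l < j)%N) p (v l)) * cum (v j).
Let wid v (m : nat) : R := \prod_(j < d | (j < m)%N) p (v j).

Let wid_ge0 v m : 0 <= wid v m.
Proof. exact: prodr_ge0. Qed.

Let widS v (j : 'I_d) : wid v j.+1 = wid v j * p (v j).
Proof.
rewrite /wid (bigD1 j) ?ltnSn//= mulrC; congr (_ * _).
by apply: eq_bigl => l; rewrite ltnS ltn_neqAle andbC.
Qed.

Let lowS v (j : 'I_d) : low v j.+1 = low v j + wid v j * cum (v j).
Proof.
rewrite /low (bigD1 j) ?ltnSn//= addrC; congr (_ + _).
by apply: eq_bigl => l; rewrite ltnS ltn_neqAle andbC.
Qed.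

Let cumD (r : 'I_k) : cum r + p r = \sum_(r' < k | (r' <= r)%N) p r'.
Proof.
rewrite [RHS](bigD1 r)//= addrC; congr (_ + _).
by apply: eq_bigl => l; rewrite ltn_neqAle andbC.
Qed.

Let le_sumP (P Q : pred 'I_k) :
  (forall r, P r -> Q r) -> \sum_(r | P r) p r <= \sum_(r | Q r) p r.
Proof.
move=> PQ; rewrite [leRHS](bigID P)/= -[leLHS]addr0 lerD ?sumr_ge0//.
rewrite le_eqVlt; apply/orP; left; apply/eqP/eq_bigl => r.
by case: (boolP (P r)) => [/PQ ->|_]; rewrite ?andbF ?andbT.
Qed.

(** A subdivision stays inside the previous interval because [cum r + p r] is at most the total
    mass, hence at most 1. *)
Let nested v m n : (m <= n <= d)%N ->
  low v m <= low v n /\ low v n + wid v n <= low v m + wid v m.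
Proof.
case/andP=> mn nd; rewrite -(subnKC mn) in nd *.
elim: (n - m)%N nd => [|e IH] nd; first by rewrite addn0 !lexx.
rewrite addnS in nd *; have [IH1 IH2] := IH (ltnW nd).
have := widS v (Ordinal nd); have := lowS v (Ordinal nd) => /= -> ->.
have cum0 : 0 <= cum (v (Ordinal nd)) by exact: sumr_ge0.
have cum1 : cum (v (Ordinal nd)) + p (v (Ordinal nd)) <= 1.
  by rewrite cumD; apply: le_trans p_le1; exact: le_sumP.
have := wid_ge0 v (m + e).
by split; nra.
Qed.

Let low0 v : low v 0 = 0. Proof. by rewrite /low big_pred0. Qed.
Let wid0 v : wid v 0 = 1. Proof. by rewrite /wid big_pred0. Qed.
Let lowd v : low v d = arith_low p v.
Proof. by apply: eq_bigl => j; rewrite ltn_ord. Qed.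
Let widd v : wid v d = arith_width p v.
Proof. by apply: eq_bigl => j; rewrite ltn_ord. Qed.

Lemma arith_low_ge0 v : 0 <= arith_low p v.
Proof. by have [] := @nested v 0 d; rewrite ?leqnn// low0 lowd. Qed.

Lemma arith_interval_le1 v : arith_low p v + arith_width p v <= 1.
Proof.
by have [] := @nested v 0 d; rewrite ?leqnn// low0 lowd wid0 widd add0r.
Qed.

(** At the first coordinate where the vectors differ, both share the same interval, whose parts for
    distinct symbols follow one another; later subdivisions stay inside those parts. *)
Lemma arith_interval_disjoint v w : v != w ->
  arith_low p v + arith_width p v <= arith_low p w \/
  arith_low p w + arith_width p w <= arith_low p v.
Proof.
move=> vw.
have /existsP/= [j0 j0P] : [exists j, v j != w j].
  apply: contraNT vw; rewrite negb_exists => /forallP e.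
  by apply/eqP/ffunP => j; apply/eqP; have := e j; rewrite negbK.
have [j vwj minj] := @arg_minnP _ j0 (fun j => v j != w j) val j0P.
have eq_l (l : 'I_d) : (l < j)%N -> v l = w l.
  by move=> lj; apply/eqP; apply: contraTT lj => /minj; rewrite -leqNgt.
have widE : wid v j = wid w j by apply: eq_bigr => l /eq_l ->.
have lowE : low v j = low w j.
  apply: eq_bigr => l lj; rewrite (eq_l l lj); congr (_ * _).
  by apply: eq_bigr => l' l'l; rewrite eq_l// (ltn_trans l'l).
have step u u' : wid u j = wid u' j -> low u j = low u' j ->
    (u j < u' j)%N -> arith_low p u + arith_width p u <= arith_low p u'.
  move=> we le lt.
  have [|_] := @nested u j.+1 d; first by rewrite ltn_ord leqnn.
  have [|+ _] := @nested u' j.+1 d; first by rewrite ltn_ord leqnn.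
  rewrite !lowd !widd !lowS widS we le => h1 h2.
  have : cum (u j) + p (u j) <= cum (u' j).
    by rewrite cumD; apply: le_sumP => r ru; apply: leq_ltn_trans lt.
  have := wid_ge0 u' j; nra.
move: vwj; rewrite -val_eqE /= neq_ltn => /orP[lt|lt].
- by left; apply: step.
- by right; apply: step.
Qed.

Lemma exists_arithmetic_code :
  exists c : {ffun 'I_d -> 'I_k} -> bitseq,
    arithmetic_code p c /\
    forall v, supported p v -> 2 ^+ size (c v) <= 4 / arith_width p v.
Proof.
have /choice [c cP] : forall v, exists b : bitseq, supported p v ->
    [/\ arith_low p v <= binfrac R b,
        binfrac R b + 2 ^- size b <= arith_low p v + arith_width p v
      & (2 ^+ size b : R) <= 4 / arith_width p v].
  move=> v; have [sv|nsv] := pselect (supported p v); last by exists [::].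
  have [|b bP] := exists_dyadic _ _ (arith_low_ge0 v) _ (arith_interval_le1 v).
    exact: prodr_gt0.
  by exists b.
by exists c; split=> v /cP [].
Qed.

(** Every continuation of a codeword of [v] has its binary value in the half-open interval of [v],
    and intervals of distinct vectors are disjoint. *)
Lemma arithmetic_code_prefix c v w a b :
  arithmetic_code p c -> supported p v -> supported p w ->
  c v ++ a = c w ++ b -> v = w.
Proof.
move=> cP sv sw e; apply/eqP/negP => /negP vw.
have inI u a' : supported p u ->
    arith_low p u <= binfrac R (c u ++ a') < arith_low p u + arith_width p u.
  move=> /cP [lo hi]; rewrite binfrac_cat.
  have /andP[a0 a1] := @binfrac_bounds R a'.
  have : 0 < 2 ^- size (c u) :> R by rewrite invr_gt0 exprn_gt0.
  by move=> ?; apply/andP; split; nra.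
have := inI v a sv; have := inI w b sw; rewrite e.
by have [] := arith_interval_disjoint _ _ vw; lra.
Qed.

End ArithmeticCoding.

(** * The normalization of the Cauchy-type weights *)

(* A primitive for the telescoping bound on the sum of 1 / ((a + r)^2 + 1):   *)
(* its increments over unit intervals dominate the summand at the midpoint.   *)
Definition cauchy_primitive {R : realType} (v : R) : R :=
  if v <= -1 then - 2 - v^-1 else if v <= 1 then v else 2 - v^-1.

Lemma cauchy_primitive_bounds {R : realType} (v : R) :
  - 2 <= cauchy_primitive v <= 2.
Proof.
rewrite /cauchy_primitive; case: (leP v (-1)) => v1.
  have vV : v * v^-1 = 1 by rewrite divff// lt_eqF//; lra.
  have v0 : v^-1 < 0 by rewrite invr_lt0; lra.
  nra.
case: (leP v 1) => v2; first by lra.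
have vV : v * v^-1 = 1 by rewrite divff// gt_eqF//; lra.
have v0 : 0 < v^-1 by rewrite invr_gt0; lra.
nra.
Qed.

Lemma cauchy_primitiveN {R : realType} (v : R) :
  cauchy_primitive (- v) = - cauchy_primitive v.
Proof.
rewrite /cauchy_primitive invrN.
have v1 : v = 1 -> v^-1 = 1 by move=> ->; rewrite invr1.
have vN1 : v = -1 -> v^-1 = -1 by move=> ->; rewrite invrN invr1.
case: (ltgtP v 1) => h1; try move: (v1 h1); case: (ltgtP v (-1)) => h2;
  try move: (vN1 h2); case: (leP (- v) (-1)) => ?; case: (leP (- v) 1) => ?; lra.
Qed.

(** [cauchy_primitive] is the odd primitive of min(1, 1 / v^2). By oddness take u >= 0; the cases
    record where the unit interval around [u] lies relative to 1. Beyond 1 the increment is 1 / (u^2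
    - 1/4). *)
Lemma cauchy_le_primitive {R : realType} (u : R) :
  (u ^+ 2 + 1)^-1 <= cauchy_primitive (u + 1 / 2) - cauchy_primitive (u - 1 / 2).
Proof.
wlog u0 : u / 0 <= u.
  move=> H; have [/H //|u0] := leP 0 u.
  have -> : u + 1 / 2 = - (- u - 1 / 2) by lra.
  have -> : u - 1 / 2 = - (- u + 1 / 2) by lra.
  rewrite !cauchy_primitiveN opprK [leRHS]addrC -sqrrN.
  by apply: H; lra.
have u2 : 0 < u ^+ 2 + 1 by nra.
rewrite -[(u ^+ 2 + 1)^-1]mul1r ler_pdivrMr// /cauchy_primitive.
rewrite ifF; last by apply/negbTE; rewrite -ltNge; lra.
rewrite [in X in _ - X]ifF; last by apply/negbTE; rewrite -ltNge; lra.
case: (leP (u + 1 / 2) 1) => h1; first by rewrite ifT; nra.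
have hp : 0 < u + 1 / 2 by lra.
have hv : (u + 1 / 2) * (u + 1 / 2)^-1 = 1 by rewrite divff// gt_eqF.
have hv0 : 0 < (u + 1 / 2)^-1 by rewrite invr_gt0.
set p := (u + 1 / 2)^-1 in hv hv0 *.
case: (leP (u - 1 / 2) 1) => h2.
  (* This concave quadratic equals 1 at both ends, 1/2 and 3/2, of the range of [u]. *)
  have q1 : 1 <= - u ^+ 2 + 2 * u + 1 / 4 by nra.
  rewrite -(ler_pM2l hp).
  have -> : (u + 1 / 2) * ((2 - p - (u - 1 / 2)) * (u ^+ 2 + 1)) =
    (2 * (u + 1 / 2) - (u + 1 / 2) * p - (u + 1 / 2) * (u - 1 / 2)) *
    (u ^+ 2 + 1) by ring.
  rewrite hv; have -> : 2 * (u + 1 / 2) - 1 - (u + 1 / 2) * (u - 1 / 2) =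
    - u ^+ 2 + 2 * u + 1 / 4 by field.
  nra.
have hq : 0 < u - 1 / 2 by lra.
have -> : (2 - p - (2 - (u - 1 / 2)^-1)) = ((u + 1 / 2) * (u - 1 / 2))^-1.
  by rewrite /p; field; lra.
by rewrite ler_pdivlMl ?mulr_gt0// mulr1; nra.
Qed.

(** The increments telescope, and the primitive takes its values in [-2, 2]. *)
Lemma sum_cauchy_le4 {R : realType} (a : R) (k : nat) :
  \sum_(r < k) ((a + r%:R) ^+ 2 + 1)^-1 <= 4.
Proof.
have : \sum_(r < k) ((a + r%:R) ^+ 2 + 1)^-1 <=
    cauchy_primitive (a + k%:R - 1 / 2) - cauchy_primitive (a - 1 / 2).
  elim: k => [|k IH]; first by rewrite big_ord0 addr0 subrr.
  rewrite big_ord_recr /=.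
  have := cauchy_le_primitive (a + k%:R).
  have -> : a + k.+1%:R - 1 / 2 = a + k%:R + 1 / 2 by rewrite -natr1; lra.
  lra.
have := cauchy_primitive_bounds (a + k%:R - 1 / 2).
have := cauchy_primitive_bounds (a - 1 / 2).
lra.
Qed.

(** * Logarithmic inequalities and empirical entropy *)

Lemma le_ln_subr1 {R : realType} (x : R) : 0 < x -> ln x <= x - 1.
Proof.
by move=> x0; rewrite -[in leLHS](subrKC 1 x) le_ln1Dx// ltrBDr addrC subrr.
Qed.

Lemma ln_prod {R : realType} {I : finType} (f : I -> R) :
  (forall i, 0 < f i) -> ln (\prod_i f i) = \sum_i ln (f i).
Proof.
move=> f0; suff [] : 0 < \prod_i f i /\ ln (\prod_i f i) = \sum_i ln (f i) by [].
elim/big_rec2: _ => [|i x y _ [y0 <-]]; first by rewrite ln1.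
by rewrite mulr_gt0// lnM ?posrE.
Qed.

(** Sum of the tangent inequality ln x <= x - 1 at w / M, which linearizes the weight, and at 1 / (a
    z w), which is the Gibbs term. *)
Lemma neg_ln_le {R : realType} (a z w M : R) :
  0 < a -> 0 < z -> 0 < w -> 0 < M ->
  - ln a <= ln (z * M) + w / M - 2 + (a * z * w)^-1.
Proof.
move=> a0 z0 w0 M0; have azw0 := mulr_gt0 (mulr_gt0 a0 z0) w0.
have := le_ln_subr1 _ (divr_gt0 w0 M0).
have := le_ln_subr1 (a * z * w)^-1; rewrite invr_gt0 => /(_ azw0).
rewrite lnV ?posrE// !lnM ?lnV ?posrE ?mulr_gt0 ?invr_gt0//.
lra.
Qed.

Lemma supported_freq {R : realType} {d k : nat} (v : {ffun 'I_d -> 'I_k}) :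
  supported (freq R d (counts v)) v.
Proof.
move=> j; rewrite divr_gt0// ltr0n; last exact: leq_ltn_trans (ltn_ord j).
by rewrite ffunE; apply/card_gt0P; exists j; rewrite inE.
Qed.

(* Gibbs' inequality for the distribution proportional to 1 / wt, with the    *)
(* logarithm of the weights linearized at M.                                  *)
Lemma empirical_entropy_le {R : realType} {d k : nat}
    (v : {ffun 'I_d -> 'I_k}) (wt : 'I_k -> R) (Z M : R) :
  0 < M -> 0 < Z -> (forall r, 0 < wt r) -> \sum_r (wt r)^-1 <= Z ->
  - ln (arith_width (freq R d (counts v)) v) <=
    d%:R * ln (Z * M) + (\sum_j wt (v j)) / M - d%:R.
Proof.
move=> M0 Z0 wt0 leZ; set p := freq R d (counts v).
have pv := @supported_freq R d k v; rewrite -/p in pv.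
have term j : - ln (p (v j)) <=
    ln (Z * M) + wt (v j) / M - 2 + (p (v j) * Z * wt (v j))^-1.
  by apply: (neg_ln_le (p (v j)) Z (wt (v j)) M (pv j) Z0 (wt0 _) M0).
(* Grouping the coordinates by symbol, [r] occurs d p(r) times, so p(r) cancels and the sum of the 1
   / wt remains; absent symbols contribute 0. *)
have mass : \sum_j (p (v j) * Z * wt (v j))^-1 <= d%:R.
  rewrite (partition_big v predT)//=.
  apply: (@le_trans _ _ (\sum_r d%:R / Z * (wt r)^-1)); last first.
    by rewrite -mulr_sumr mulrAC -mulrA ler_piMr// ler_pdivrMr// mul1r.
  apply: ler_sum => r _.
  rewrite (eq_bigr (fun=> (p r * Z * wt r)^-1)); last by move=> j1 /eqP ->.
  rewrite sumr_const -[leLHS]mulr_natl.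
  have -> : #|[pred j | v j == r]| = counts v r by rewrite ffunE cardsE.
  rewrite /p /freq; have [->|h0] := posnP (counts v r).
    by rewrite mul0r mulr_ge0// ?divr_ge0// ?invr_ge0 ltW.
  rewrite !invfM invrK; set h : R := (counts v r)%:R.
  have h0' : h != 0 by rewrite pnatr_eq0 -lt0n.
  by rewrite !mulrA mulfV// mul1r.
rewrite /arith_width ln_prod// -sumrN.
apply: (le_trans (ler_sum _ (fun j _ => term j))).
rewrite !big_split/= !sumr_const card_ord -mulr_suml mulNrn -[_ *+ d]mulr_natl.
rewrite -[2 *+ d]mulr_natl; move: mass.
move: (ln (Z * M)) (\sum_j wt (v j)) (\sum_i _) => a b c mass.
lra.
Qed.

(** * Expectations under a product law *)

Section ProductLaw.
Context {R : realType} {I J : finType} (F : I -> J -> R).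
Context (F1 : forall i, \sum_j F i j = 1).

Lemma product_law_mass : \sum_(f : {ffun I -> J}) \prod_i F i (f i) = 1.
Proof. by rewrite -bigA_distr_bigA big1. Qed.

Lemma product_law_expectation (g : I -> J -> R) :
  \sum_(f : {ffun I -> J}) (\prod_i F i (f i)) * (\sum_i g i (f i)) =
  \sum_i \sum_j F i j * g i j.
Proof.
under eq_bigr do rewrite mulr_sumr.
rewrite exchange_big/=; apply: eq_bigr => i0 _.
(* Absorbing [g] into the factor at [i0] keeps the summand a product, so it factorizes over
   coordinates; the other factors have mass 1. *)
pose G i j := if i == i0 then F i j * g i j else F i j.
transitivity (\sum_(f : {ffun I -> J}) \prod_i G i (f i)).
  apply: eq_bigr => f _; rewrite (bigD1 i0)//= [RHS](bigD1 i0)//= /G eqxx.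
  rewrite mulrAC; congr (_ * _).
  by apply: eq_bigr => i /negbTE ->.
rewrite -bigA_distr_bigA (bigD1 i0)//= [X in _ * X]big1 ?mulr1.
  by apply: eq_bigr => j _; rewrite /G eqxx.
by move=> i /negbTE ii0; rewrite -[RHS](F1 i); apply: eq_bigr; rewrite /G ii0.
Qed.

End ProductLaw.

(** * Mean and variance of one quantized coordinate *)

(** In the unit s / (k - 1) the levels are integers: [q0] is the integer part of the rescaled
    coordinate and [t] its fractional part, except at the top level. *)
Lemma bin_lawE {R : realType} (k : nat) (m s x : R) :
  (1 < k)%N -> 0 < s -> m <= x <= m + s ->
  exists (q0 q1 : 'I_k) (t : R),
    [/\ 0 <= t <= 1, q1 = q0.+1 :> nat,
        (x - m) * k.-1%:R / s = q0%:R + t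
      & forall r, bin_law m s x r = (r == q1)%:R * t + (r == q0)%:R * (1 - t)].
Proof.
case: k => [//|[//|K]] _ s0 /andP[mx xs].
have K0 : 0 < K.+1%:R :> R by rewrite ltr0n.
set u := (x - m) * _ / s.
have u0 : 0 <= u by rewrite divr_ge0 ?mulr_ge0 ?subr_ge0// ltW.
have xE : x = m + u * s / K.+1%:R.
  by rewrite /u /=; field; rewrite !gt_eqF.
have level_le r : (level K.+2 m s r <= x) = (r%:R <= u).
  by rewrite xE /level lerD2l ler_pM2r ?invr_gt0// ler_pM2r.
have level_lt r : (x < level K.+2 m s r) = (u < r%:R).
  by rewrite !real_ltNge ?num_real// level_le.
have level_eq r r' : (level K.+2 m s r == level K.+2 m s r') = (r == r').
  have Kn : K.+1%:R^-1 != 0 :> R by rewrite invr_eq0 gt_eqF.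
  rewrite /level (inj_eq (addrI m)) (inj_eq (mulIf Kn)).
  by rewrite (inj_eq (mulIf (lt0r_neq0 s0))) eqr_nat.
rewrite /bin_law gt_eqF//= /quant_law.
have [xK|xK] := eqVneq x (level K.+2 m s K.+1).
  (* The point mass at the top level is written with [t = 1] in the last bin, so that [q1] stays
     below [k]. *)
  exists (inord K), ord_max, 1; split=> /=; rewrite ?inordK ?lexx ?ler01//.
    by rewrite natr1 /u xK /level /=; field; rewrite !gt_eqF.
  by move=> r; rewrite subrr mulr0 addr0 mulr1 xK level_eq.
have uK : u < K.+1%:R.
  rewrite -level_lt lt_neqAle xK/= /level; apply: le_trans xs _.
  by rewrite [_ * s]mulrC mulfK ?gt_eqF.
have /andP[tl tu] := truncn_itv u0; set n := Num.truncn u in tl tu.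
have nK : (n < K.+1)%N by rewrite -(ltr_nat R); exact: le_lt_trans uK.
exists (inord n), (inord n.+1), (u - n%:R).
rewrite !inordK// ?ltnS ?(ltnW nK)//; split=> //.
- by move: tu; rewrite -natr1; lra.
- by rewrite subrKC.
move=> r; rewrite (big_pred1 (Ordinal nK)); last first.
  by move=> r'; rewrite level_le level_lt -truncn_eq// eq_sym.
rewrite !level_eq /=.
have -> : (x - level K.+2 m s n) / (level K.+2 m s n.+1 - level K.+2 m s n) =
    u - n%:R.
  have -> : level K.+2 m s n.+1 - level K.+2 m s n = s / K.+1%:R.
    by rewrite /level -[n.+1%:R]natr1 /=; field; rewrite ?natr1 gt_eqF.
  by rewrite {1}xE /level /=; field; rewrite ?natr1 !gt_eqF.
by rewrite -!val_eqE /= !inordK// ?ltnS ?(ltnW nK).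
Qed.

(* The statement covers s = 0, where all the indices are 0 and x / s = 0.     *)
Lemma bin_law_moments {R : realType} (k : nat) (m s x : R) :
  (1 < k)%N -> 0 <= s -> m <= x <= m + s ->
  [/\ forall r : 'I_k, 0 <= bin_law m s x r,
      \sum_(r < k) bin_law m s x r = 1
    & \sum_(r < k) bin_law m s x r * (k.-1%:R * m / s + r%:R) ^+ 2 <=
      (k.-1%:R * x / s) ^+ 2 + 1 / 4].
Proof.
move=> k1 s0 mxs; have [s_eq0|sn0] := eqVneq s 0.
  rewrite /bin_law s_eq0 eqxx invr0 !mulr0 expr0n add0r.
  have k0 : (0 < k)%N by exact: ltnW.
  have sumE (g : 'I_k -> R) :
      \sum_(r < k) (val r == 0%N)%:R * g r = g (Ordinal k0).
    rewrite (bigD1 (Ordinal k0))//= mul1r big1 ?addr0// => r.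
    by rewrite -val_eqE /= => /negbTE ->; rewrite mul0r.
  split=> [r||]; first exact: ler0n.
  - by rewrite -[RHS](sumE (fun=> 1)); apply: eq_bigr => r _; rewrite mulr1.
  - by rewrite sumE /= addr0 expr0n /=; lra.
have {s0 sn0}s0 : 0 < s by rewrite lt_neqAle eq_sym sn0.
have [q0 [q1 [t [t01 q1E tE lawE]]]] := bin_lawE k m s x k1 s0 mxs.
have sumE (g : 'I_k -> R) :
    \sum_(r < k) bin_law m s x r * g r = t * g q1 + (1 - t) * g q0.
  under eq_bigr do rewrite lawE mulrDl.
  rewrite big_split/=; congr (_ + _).
  - rewrite (bigD1 q1)//= eqxx mul1r big1 ?addr0// => r /negbTE ->.
    by rewrite !mul0r.
  - rewrite (bigD1 q0)//= eqxx mul1r big1 ?addr0// => r /negbTE ->.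
    by rewrite !mul0r.
split=> [r||].
- rewrite lawE addr_ge0// mulr_ge0 ?ler0n//; lra.
- under eq_bigr do rewrite -[bin_law _ _ _ _]mulr1.
  by rewrite sumE; lra.
rewrite sumE q1E -natr1.
have -> : k.-1%:R * x / s = k.-1%:R * m / s + q0%:R + t.
  by rewrite -addrA -tE; ring.
rewrite addrA; set a := k.-1%:R * m / s + q0%:R.
(* The variance t (1 - t) of a Bernoulli variable is at most 1 / 4.           *)
have := sqr_ge0 (t - 1 / 2); lra.
Qed.

(** * Range of the coordinates and rounding of the two reals *)

Lemma xmin_attained {R : realType} {d : nat} (x : 'rV[R]_d) : (0 < d)%N ->
  exists j, xmin x = x ord0 j /\ forall j', x ord0 j <= x ord0 j'.
Proof.
move=> d0; have [j _ minj] := Order.TotalTheory.arg_minP (x ord0) (isT : predT (Ordinal d0)).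
exists j; split=> [|j']; last exact: minj.
have lb : lbound (range (x ord0)) (x ord0 j) by move=> _ [j' _ <-]; exact: minj.
apply/eqP; rewrite eq_le; apply/andP; split.
- by apply: ge_inf; [exists (x ord0 j) | exists j].
- by apply: lb_le_inf => //; exists (x ord0 j), j.
Qed.

Lemma l2norm_ge0 {R : realType} {d : nat} (x : 'rV[R]_d) : 0 <= l2norm x.
Proof. exact: sqrtr_ge0. Qed.

Lemma sqr_l2norm {R : realType} {d : nat} (x : 'rV[R]_d) :
  l2norm x ^+ 2 = \sum_j x ord0 j ^+ 2.
Proof. by rewrite sqr_sqrtr// sumr_ge0// => j _; exact: sqr_ge0. Qed.

Lemma coord_le_l2norm {R : realType} {d : nat} (x : 'rV[R]_d) j :
  `|x ord0 j| <= l2norm x.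
Proof.
rewrite -ler_sqr ?nnegrE ?l2norm_ge0// real_normK ?num_real// sqr_l2norm.
by rewrite (bigD1 j)//= lerDl sumr_ge0// => *; exact: sqr_ge0.
Qed.

(** Uses (a - b)^2 <= 2 (a^2 + b^2) for two distinct coordinates; hence the factor sqrt 2 in the
    scale. *)
Lemma coord_xmin_le {R : realType} {d : nat} (x : 'rV[R]_d) j :
  xmin x <= x ord0 j <= xmin x + Num.sqrt 2 * l2norm x.
Proof.
have [j0 [-> minj0]] := xmin_attained x (leq_ltn_trans (leq0n j) (ltn_ord j)).
rewrite minj0/= -lerBlDl.
have nn : 0 <= Num.sqrt 2 * l2norm x by rewrite mulr_ge0 ?sqrtr_ge0 ?l2norm_ge0.
rewrite -ler_sqr ?nnegrE ?subr_ge0// exprMn sqr_sqrtr// sqr_l2norm.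
have [->|jj0] := eqVneq j j0.
  by rewrite subrr expr0n mulr_ge0// sumr_ge0// => *; exact: sqr_ge0.
rewrite (bigD1 j)//= (bigD1 j0) 1?eq_sym//=.
have : 0 <= \sum_(i < d | (i != j) && (i != j0)) x ord0 i ^+ 2.
  by apply: sumr_ge0 => *; exact: sqr_ge0.
have := sqr_ge0 (x ord0 j + x ord0 j0); lra.
Qed.

(** [m + N] and [s] both lie in [0, 2N] and are rounded down to multiples of N / T, with indices at
    most 2T < 4T. Positivity of [L] later makes every message nonempty. *)
Lemma exists_reals_code {R : realType} (N : R) (T : nat) : (0 < T)%N ->
  exists (L : nat) (f : R -> R -> bitseq) (dec : bitseq -> R * R),
    [/\ forall m s, size (f m s) = L, (0 < L)%N,
        L%:R <= log2 (16 * T%:R ^+ 2) + 1 :> R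
      & forall m s, `|m| <= N -> 0 <= s <= 2 * N ->
        `|(dec (f m s)).1 - m| <= N / T%:R /\
        `|(dec (f m s)).2 - s| <= N / T%:R].
Proof.
move=> T0; have T0' : 0 < T%:R :> R by rewrite ltr0n.
pose A := (4 * T)%N; have A0 : (0 < A)%N by rewrite muln_gt0.
pose L := up_log 2 (A * A).
have [|code [code_inj code_size]] := @exists_fixed_length_code _ [set: 'I_A * 'I_A]%SET L.
  by rewrite cardsT card_prod card_ord; exact: up_logP.
pose cell (y : R) : 'I_A := insubd (Ordinal A0) (Num.truncn (y / N * T%:R)).
pose val_ (a : 'I_A) : R := a%:R * N / T%:R.
have cellP y : 0 <= y <= 2 * N -> `|val_ (cell y) - y| <= N / T%:R.
  move=> /andP[y0 y2]; have [N0|N0] := eqVneq N 0.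
    have -> : y = 0 by move: y2; rewrite N0; lra.
    by rewrite /val_ N0 mulr0 !mul0r subrr normr0.
  have {}N0 : 0 < N by rewrite lt_neqAle eq_sym N0; lra.
  have z0 : 0 <= y / N * T%:R by rewrite mulr_ge0 ?divr_ge0// ltW.
  have /andP[tl tu] := truncn_itv z0.
  have tA : (Num.truncn (y / N * T%:R) < A)%N.
    rewrite -(ltr_nat R); apply: le_lt_trans tl _.
    apply: (@le_lt_trans _ _ (2 * T%:R)).
      by rewrite ler_wpM2r// ?ler_pdivrMr// ltW.
    by rewrite natrM ltr_pM2r// ltr_nat.
  rewrite /val_ /cell val_insubd tA; set t := (Num.truncn _)%:R in tl *.
  move: tu; rewrite -natr1 -/t => tu.
  have yE : y = (y / N * T%:R) * (N / T%:R) by field; rewrite !gt_eqF.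
  rewrite [X in _ - X]yE -mulrA -mulrBl normrM [X in _ * X]gtr0_norm ?divr_gt0//.
  apply: ler_piMl; first by rewrite divr_ge0// ltW.
  by rewrite ler_norml; lra.
have /choice [dec decP] : forall b : bitseq, exists q : 'I_A * 'I_A,
    forall q', code q' = b -> q = q'.
  move=> b; have [[q qb]|no] := pselect (exists q, code q = b).
    by by exists q => q' q'b; apply: code_inj; rewrite ?inE// q'b.
  by exists (Ordinal A0, Ordinal A0) => q' q'b; case: no; exists q'.
exists L, (fun m s => code (cell (m + N), cell s)),
  (fun b => (val_ (dec b).1 - N, val_ (dec b).2)); split=> [m s|||m s].
- exact: code_size.
- by rewrite up_log_gt0/=; rewrite /A; nia.
- have -> : 16 * T%:R ^+ 2 = (A * A)%:R :> R by rewrite /A !natrM; ring.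
  by apply: up_log2_le; rewrite muln_gt0 A0.
- move=> mN sN; rewrite (decP _ _ erefl)/=; split; last exact: cellP.
  have := cellP (m + N); rewrite opprD addrA addrAC; apply.
  by move: mN; rewrite ler_norml; lra.
Qed.

(** * Expected length and assembly of the protocol *)

(** The squares of the rescaled coordinates sum to at most (k - 1)^2 / 2, as s^2 is twice the
    squared norm. Each coordinate adds 1/4 for the variance and 1 from the weight. *)
Lemma expected_weight_le {R : realType} {d k : nat} (x : 'rV[R]_d) (s : R) :
  (0 < d)%N -> (1 < k)%N -> s = Num.sqrt 2 * l2norm x ->
  \sum_j \sum_(r < k) bin_law (xmin x) s (x ord0 j) r *
    ((k.-1%:R * xmin x / s + r%:R) ^+ 2 + 1) <=
  d%:R * (k.-1%:R ^+ 2 / (2 * d%:R) + 5 / 4).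
Proof.
move=> d0 k1 sE; have s0 : 0 <= s by rewrite sE mulr_ge0 ?sqrtr_ge0 ?l2norm_ge0.
have d0' : 0 < d%:R :> R by rewrite ltr0n.
have xs j : xmin x <= x ord0 j <= xmin x + s by rewrite sE coord_xmin_le.
apply: (@le_trans _ _ (\sum_j ((k.-1%:R * x ord0 j / s) ^+ 2 + 5 / 4))).
  apply: ler_sum => j _.
  have [_ law1 law2] := bin_law_moments k _ _ _ k1 s0 (xs j).
  under eq_bigr do rewrite mulrDr mulr1.
  by rewrite big_split/= law1; lra.
rewrite big_split/= sumr_const card_ord -[X in _ + X <= _]mulr_natl.
have -> : \sum_j (k.-1%:R * x ord0 j / s) ^+ 2 =
    k.-1%:R ^+ 2 * (\sum_j x ord0 j ^+ 2) / s ^+ 2.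
  rewrite mulr_sumr mulr_suml; apply: eq_bigr => j _.
  by rewrite expr_div_n exprMn.
have -> : d%:R * (k.-1%:R ^+ 2 / (2 * d%:R) + 5 / 4) =
    k.-1%:R ^+ 2 / 2 + d%:R * (5 / 4) :> R by field; rewrite gt_eqF.
rewrite lerD2r -sqr_l2norm sE exprMn (@sqr_sqrtr _ 2)//.
(* For the zero vector [s = 0], and division by 0 gives 0. *)
have [->|x0] := eqVneq (l2norm x) 0.
  by rewrite expr0n /= !mulr0 mul0r divr_ge0// sqr_ge0.
by rewrite -mulf_div divff ?mulr1// sqrf_eq0.
Qed.

Lemma expected_index_bits_le {R : realType} {d k : nat} (x : 'rV[R]_d)
    (s a b : R) :
  (0 < d)%N -> (1 < k)%N -> s = Num.sqrt 2 * l2norm x -> 0 <= b ->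
  \sum_(v : {ffun 'I_d -> 'I_k}) index_law s x v *
    (a - b * ln (arith_width (freq R d (counts v)) v)) <=
  a + b * (d%:R * ln (4 * (k.-1%:R ^+ 2 / (2 * d%:R) + 5 / 4))).
Proof.
move=> d0 k1 sE b0; set M := k.-1%:R ^+ 2 / _ + _.
have d0' : 0 < d%:R :> R by rewrite ltr0n.
have xs j : xmin x <= x ord0 j <= xmin x + s by rewrite sE coord_xmin_le.
have s0 : 0 <= s by rewrite sE mulr_ge0 ?sqrtr_ge0 ?l2norm_ge0.
have M0 : 0 < M.
  by rewrite ltr_wpDl ?divr_gt0// divr_ge0 ?sqr_ge0// mulr_ge0 ?ler0n.
pose wt (r : 'I_k) : R := (k.-1%:R * xmin x / s + r%:R) ^+ 2 + 1.
have wt0 r : 0 < wt r by rewrite ltr_wpDl ?sqr_ge0.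
pose F (j : 'I_d) (r : 'I_k) : R := bin_law (xmin x) s (x ord0 j) r.
have F0 j r : 0 <= F j r.
  by have [law_ge0 _ _] := bin_law_moments k _ _ _ k1 s0 (xs j); exact: law_ge0.
have F1 j : \sum_r F j r = 1.
  by have [_ law1 _] := bin_law_moments k _ _ _ k1 s0 (xs j); exact: law1.
have EwM : \sum_(v : {ffun 'I_d -> 'I_k})
    (\prod_j F j (v j)) * \sum_j wt (v j) <= d%:R * M.
  rewrite (product_law_expectation F F1 (fun=> wt)).
  exact: expected_weight_le.
have Z4 : \sum_r (wt r)^-1 <= 4 by exact: sum_cauchy_le4.
(* The - d of the linearized entropy is compensated by the expected weights, which contribute at
   most d M / M. *)
pose c := a + b * (d%:R * ln (4 * M) - d%:R).
apply: (@le_trans _ _ (\sum_(v : {ffun 'I_d -> 'I_k})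
    (c * (\prod_j F j (v j)) +
     b / M * ((\prod_j F j (v j)) * \sum_j wt (v j))))).
  apply: ler_sum => v _.
  have := empirical_entropy_le v wt 4 M M0 (ltr0n _ _) wt0 Z4.
  rewrite /index_law -/(F _ _); set w := ln (arith_width _ _) => le_w.
  have -> : c * (\prod_j F j (v j)) +
     b / M * ((\prod_j F j (v j)) * \sum_j wt (v j)) =
     (\prod_j F j (v j)) * (c + b * ((\sum_j wt (v j)) / M)) by ring.
  apply: ler_wpM2l; first by apply: prodr_ge0 => j _; exact: F0.
  have := ler_wpM2l b0 le_w; rewrite /c; lra.
rewrite big_split/= -!mulr_sumr (product_law_mass F F1).
have : b / M * (d%:R * M) = b * d%:R by field; rewrite gt_eqF.
have bM : 0 <= b / M by rewrite divr_ge0// ltW.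
have := ler_wpM2l bM EwM; rewrite /c; lra.
Qed.

Theorem theorem4 (R : realType) :
  exists C : R, forall (n d k : nat) (N : R),
    (1 <= n)%N -> (1 <= d)%N -> (2 < k)%N -> (2 <= d * n)%N ->
    let scale : 'rV[R]_d -> R := fun x => Num.sqrt 2 * l2norm x in
    exists P : svk_coding R n d k,
      svk_implementation N scale P /\
      forall X : 'I_n -> 'rV[R]_d,
        (forall i, l2norm (X i) <= N) ->
        svk_cost scale P X <=
          n%:R * (d%:R * (2 + log2 ((k%:R - 1) ^+ 2 / (2 * d%:R) + 5 / 4))
                  + k%:R * log2 ((d%:R + k%:R) * expR 1 / k%:R)
                  + C * ln (d * n)%:R).
Proof.
have ln2 : 0 < ln 2 :> R by rewrite ln_gt0// ltr1n.
(* The reals cost at most 5 + 6 log2 (dn) bits, rounding up the counts 1 and the arithmetic code 2;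
   as log2 (dn) >= 1, the total 8 + 6 log2 (dn) is at most 14 log2 (dn). *)
exists (14 / ln 2) => n d k N n1 d1 k2 dn2 scale.
have k1 : (1 < k)%N by exact: ltnW.
have k0 : (0 < k)%N by exact: ltnW.
have d0' : 0 < d%:R :> R by rewrite ltr0n.
have T0 : (0 < (n * d) ^ 3)%N by rewrite expn_gt0 muln_gt0 n1 d1.
have [L1 [enc_r [dec_r [size_r L1_gt0 L1_le dec_rP]]]] :=
  exists_reals_code N _ T0.
have [L2 [enc_c [enc_c_inj size_c L2_le]]] := @exists_counts_code R d k k0.
have freq_ge0 (h : {ffun 'I_k -> nat}) r : 0 <= freq R d h r.
  by rewrite divr_ge0// ler0n.
have freq_sum (v : {ffun 'I_d -> 'I_k}) : \sum_r freq R d (counts v) r <= 1.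
  by rewrite -mulr_suml -natr_sum sum_counts divff// gt_eqF.
have /choice [enc_v enc_vP] : forall h : {ffun 'I_k -> nat},
    exists c : {ffun 'I_d -> 'I_k} -> bitseq,
    (exists v : {ffun 'I_d -> 'I_k}, h = counts v) ->
    arithmetic_code (freq R d h) c /\ forall v, supported (freq R d h) v ->
      2 ^+ size (c v) <= 4 / arith_width (freq R d h) v.
  move=> h; have [[v ->]|no] := pselect (exists v : {ffun 'I_d -> 'I_k}, h = counts v).
    have [c cP] := @exists_arithmetic_code R d k _ (freq_ge0 _) (freq_sum v).
    by exists c.
  by exists (fun=> [::]).
pose P := SvkCoding (fun=> enc_r) (fun=> enc_c) (fun=> enc_v) : svk_coding R n d k.
(* Equal lengths align the first two parts; the counts then agree, so both index words come from the
   same arithmetic code. Of the reals only their codeword is recovered. *)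
have message_prefix i m s v m' s' v' a b :
    message P i m s v ++ a = message P i m' s' v' ++ b ->
    enc_r m s = enc_r m' s' /\ v = v'.
  rewrite /message /= -!catA => /eqP.
  rewrite eqseq_cat ?size_r// => /andP[/eqP -> ].
  rewrite eqseq_cat ?size_c// => /andP[/eqP /enc_c_inj eq_counts /eqP].
  have [code_v _] := enc_vP (counts v) (ex_intro _ v erefl).
  rewrite -eq_counts => e; split=> //.
  apply: (arithmetic_code_prefix (freq R d (counts v)) (freq_ge0 _)
    (freq_sum v) (enc_v (counts v)) v v' a b code_v _ _ e).
  - exact: supported_freq.
  - by rewrite eq_counts; exact: supported_freq.
have scale_ge0 x : 0 <= scale x by rewrite mulr_ge0 ?sqrtr_ge0 ?l2norm_ge0.
exists P; split=> [i|X _].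
  split=> [|v /=|/=|].
  - exact: enc_c_inj.
  - by left; have [] := enc_vP (counts v) (ex_intro _ v erefl).
  - apply: prefix_free_uniquely_decodable => [u w a b|].
      move=> [x [v [_ ->]]] [x' [v' [_ ->]]] /message_prefix [r_eq ->].
      by rewrite /message /= r_eq.
    move=> [x [v [_ /(congr1 size)]]].
    by rewrite /message /= !size_cat size_r => /esym/eqP; rewrite addn_eq0 gtn_eqF.
  have /choice [dec_v dec_vP] : forall b : bitseq,
      exists v : {ffun 'I_d -> 'I_k}, forall x w, b = message P i (xmin x) (scale x) w -> v = w.
    move=> b; have [[v [x bE]]|no] :=
        pselect (exists v x, b = message P i (xmin x) (scale x) v).
      exists v => y w; rewrite bE => e.
      have := message_prefix i (xmin x) (scale x) v (xmin y) (scale y) w [::] [::].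
      by rewrite !cats0 => /(_ e) [].
    by exists [ffun=> Ordinal k0] => x w bE; case: no; exists w, x.
  exists (fun b => (dec_r (take L1 b), dec_v b)) => x v xN.
  rewrite (dec_vP _ x v erefl) /message /= take_size_cat ?size_r//.
  have [||dec1 dec2] := dec_rP (xmin x) (scale x).
  - have [j [-> _]] := xmin_attained x d1.
    exact: le_trans (coord_le_l2norm x j) xN.
  - rewrite scale_ge0/=.
    have sqrt2 : Num.sqrt 2 <= 2 :> R.
      by have := sqr_sqrtr (ler0n R 2); have := sqrtr_ge0 (2 : R); nra.
    by rewrite ler_pM ?sqrtr_ge0 ?l2norm_ge0.
  case: (dec_r _) dec1 dec2 => m' s' /=; rewrite natrX => dec1 dec2.
  by split.
rewrite /svk_cost mulr_natl -[X in _ <= _ *+ X](card_ord n) -sumr_const.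
apply: ler_sum => i _.
set x := X i; set M := (k%:R - 1) ^+ 2 / _ + _.
have kE : k.-1%:R = k%:R - 1 :> R by rewrite -[in RHS](prednK k0) -natr1 addrK.
(* The factor 1 / ln 2 converts natural logarithms to bits. *)
have bits_le :=
  expected_index_bits_le x (scale x) ((L1 + L2)%:R + 2) (ln 2)^-1 d1 k1 erefl.
rewrite invr_ge0 (ltW ln2) kE -/M in bits_le.
have law_ge0 (v : {ffun 'I_d -> 'I_k}) : 0 <= index_law (scale x) x v.
  apply: prodr_ge0 => j _.
  have [law_ge0 _ _] :=
    bin_law_moments k _ _ _ k1 (scale_ge0 x) (coord_xmin_le x j).
  exact: law_ge0.
have size_v (v : {ffun 'I_d -> 'I_k}) :
    (size (message P i (xmin x) (scale x) v))%:R <=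
    (L1 + L2)%:R + 2 - (ln 2)^-1 * ln (arith_width (freq R d (counts v)) v).
  have sv := supported_freq (R := R) v.
  have w0 : 0 < arith_width (freq R d (counts v)) v by exact: prodr_gt0.
  have [_ /(_ v sv) le_size] := enc_vP (counts v) (ex_intro _ v erefl).
  rewrite /message /= !size_cat size_r size_c addnA natrD -addrA lerD2l.
  set w := arith_width _ _ in w0 le_size *.
  have : ln (2 ^+ size (enc_v (counts v) v)) <= ln (2 ^+ 2 / w).
    by rewrite ler_ln ?posrE ?exprn_gt0 ?divr_gt0 ?exprn_gt0// -[2 ^+ 2]natrX.
  rewrite ln_div ?posrE ?exprn_gt0// !lnXn//.
  rewrite -[ln 2 *+ size _]mulr_natl -[ln 2 *+ 2]mulr_natl.
  rewrite -ler_pdivlMr// => /le_trans; apply.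
  by rewrite mulrBl mulfK ?gt_eqF// [ln w / _]mulrC.
apply: le_trans; first by apply: ler_sum => v _; exact: ler_wpM2l.
apply: (le_trans (bits_le isT)).
have nd2 : 2 <= (d * n)%:R :> R by rewrite ler_nat.
have nd0 : 0 < (d * n)%:R :> R by exact: lt_le_trans nd2.
have M0 : 0 < M.
  by rewrite ltr_wpDl ?divr_gt0// divr_ge0 ?sqr_ge0// mulr_ge0 ?ler0n.
have log_nd : 1 <= log2 (d * n)%:R :> R.
  by rewrite ler_pdivlMr// mul1r ler_ln ?posrE.
have log4 : ln 4 = 2 * ln 2 :> R by rewrite (natrM _ 2 2) lnM ?posrE//; ring.
have -> : (ln 2)^-1 * (d%:R * ln (4 * M)) = d%:R * (2 + log2 M).
  by rewrite lnM ?posrE// log4 /log2; field; rewrite gt_eqF.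
have logT : log2 (16 * ((n * d) ^ 3)%:R ^+ 2) = 4 + 6 * log2 (d * n)%:R :> R.
  rewrite mulnC natrX -exprM (_ : 16 = 2 ^+ 4 :> R); last by rewrite -natrX.
  rewrite /log2 lnM ?posrE ?exprn_gt0// !lnXn//.
  rewrite -[ln 2 *+ _]mulr_natl -[ln (d * n)%:R *+ _]mulr_natl.
  by field; rewrite gt_eqF.
have -> : 14 / ln 2 * ln (d * n)%:R = 14 * log2 (d * n)%:R :> R.
  by rewrite /log2 mulrAC mulrA.
move: L1_le L2_le; rewrite logT natrD; lra.
Qed.
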